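(* Let $G'\subset\Omega$ be a domain. Scalar functions $F_1,\ldots,F_k$ on $G'$ form a basis of first integrals on $G'$ of the Pfaff system of equations $$\omega_j(x)=0,\qquad j=1,\ldots,m,$$ with $\omega_j\in C(G)$, $j=1,\ldots,m$, if and only if $F_1,\ldots,F_k$ form a basis of first integrals on $G'$ of the system of total differential equations $$dx_j=\sum_{\nu=m+1}^n\widehat a_{j\nu}(x)\,dx_\nu,\qquad j=1,\ldots,m,$$ obtained by solving the Pfaff system for $dx_1,\ldots,dx_m$.
   Context: A domain is an open arcwise connected set. $G\subset\mathbb R^n$ is a domain, $m\le n$, and $\omega_j(x)=\sum_{i=1}^n w_{ji}(x)\,dx_i$, $j=1,\ldots,m$, are linear differential forms on $G$ with continuous coefficients. $\Omega\subset G$ is a domain whose complement in $G$ has measure zero and on which the $m\times m$ matrix $\widehat w(x)=\|w_{ji}(x)\|_{1\le j,i\le m}$ (the first $m$ columns of the coefficient matrix) is nonsingular. The coefficients $\widehat a_{j\nu}$ on $\Omega$ are the entries of $-\widehat w(x)^{-1}\|w_{j\nu}(x)\|_{1\le j\le m,\ m<\nu\le n}$. A first integral of the Pfaff system on $G'$ is a function $F\in C^1(G')$ for which there exist $a_j\in C(G')$, $j=1,\ldots,m$, with $dF(x)=\sum_{j=1}^m a_j(x)\,\omega_j(x)$ for all $x\in G'$. A first integral on $G'$ of the total differential system (independent variables $x_{m+1},\ldots,x_n$, dependent variables $x_1,\ldots,x_m$) is a function $F\in C^1(G')$ with $\partial_{x_\nu}F(x)+\sum_{j=1}^m\widehat a_{j\nu}(x)\,\partial_{x_j}F(x)=0$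 for all $x\in G'$, $\nu=m+1,\ldots,n$. For either system, a basis of first integrals on $G'$ (of dimension $k$) is a set of functionally independent first integrals $F_1,\ldots,F_k$ on $G'$ such that every first integral $\Psi$ on $G'$ has the form $\Psi(x)=\Phi(F_1(x),\ldots,F_k(x))$ for all $x\in G'$, where $\Phi$ is some function of class $C^1(\mathrm EF)$ and $\mathrm EF\subset\mathbb R^k$ is the range of $(F_1,\ldots,F_k)$. Functionally independent means that the Jacobi matrix of $(F_1,\ldots,F_k)$ has rank $k$ almost everywhere on $G'$. *)

(* Defs.v *)
From HB Require Import structures.
From mathcomp Require Import all_boot all_order all_algebra.
From mathcomp Require Import all_classical all_reals all_analysis.

Set Implicit Arguments.
Unset Strict Implicit.
Unset Printing Implicit Defensive.

Import Order.TTheory GRing.Theory Num.Theory.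
Import numFieldNormedType.Exports.

Local Open Scope classical_set_scope.
Local Open Scope ring_scope.

(* Points of R^n are row vectors 'rV[R]_n. A function on a
   subset of R^n is a total function of which only the values on that subset
   matter. *)

Section Pfaff.
Context {R : realType}.

Definition arcwise_connected n (A : set 'rV[R]_n) : Prop :=
  forall x y, A x -> A y -> exists g : R -> 'rV[R]_n,
    [/\ {within `[0, 1], continuous g}, g 0 = x, g 1 = y &
        forall t, 0 <= t <= 1 -> A (g t)].

Definition domain n (A : set 'rV[R]_n) : Prop :=
  open A /\ arcwise_connected A.

Definition box n (a b : 'rV[R]_n) : set 'rV[R]_n :=
  [set x | forall j, a 0 j <= x 0 j <= b 0 j].

(* Lebesgue measure zero in R^n: for every e > 0 there is an at most countable
   covering by boxes (indexed by D) of total volume at most e. *)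
Definition measure_zero n (A : set 'rV[R]_n) : Prop :=
  forall e : R, 0 < e ->
    exists (D : set nat) (a b : nat -> 'rV[R]_n),
      [/\ forall i j, a i 0 j <= b i 0 j,
          A `<=` \bigcup_(i in D) box (a i) (b i) &
          (\esum_(i in D) (\prod_(j < n) (b i 0 j - a i 0 j))%:E <= e%:E)%E].

Definition partial n (i : 'I_n) (f : 'rV[R]_n -> R) (x : 'rV[R]_n) : R :=
  'D_(delta_mx 0 i) f x.

Definition C1_open n (U : set 'rV[R]_n) (f : 'rV[R]_n -> R) : Prop :=
  (forall x, U x -> differentiable f x) /\
  (forall i, {within U, continuous (partial i f)}).

(* The range of a basis of first integrals need not be open: on an arbitrary
   set, class C^1 means being the restriction of a C^1 function defined on an
   open neighbourhood of that set. *)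
Definition C1 n (A : set 'rV[R]_n) (f : 'rV[R]_n -> R) : Prop :=
  exists (U : set 'rV[R]_n) (g : 'rV[R]_n -> R),
    [/\ open U, A `<=` U, C1_open U g & forall y, A y -> f y = g y].

(* The value on v of the form omega_j(x) = \sum_i w_ji(x) dx_i. *)
Definition omega m n (w : 'rV[R]_n -> 'M[R]_(m, n)) (j : 'I_m)
    (x v : 'rV[R]_n) : R :=
  \sum_(i < n) w x j i * v 0 i.

Definition pfaff_first_integral m n (w : 'rV[R]_n -> 'M[R]_(m, n))
    (G : set 'rV[R]_n) (F : 'rV[R]_n -> R) : Prop :=
  C1_open G F /\
  exists a : 'I_m -> 'rV[R]_n -> R,
    (forall j, {within G, continuous (a j)}) /\
    (forall x, G x -> forall v, 'd F x v = \sum_(j < m) a j x * omega w j x v).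

(* Here n = m + p: the dependent variables are the first m coordinates
   (lshift p j), the independent ones the last p (rshift m nu). *)
Definition total_first_integral m p (a : 'rV[R]_(m + p) -> 'M[R]_(m, p))
    (G : set 'rV[R]_(m + p)) (F : 'rV[R]_(m + p) -> R) : Prop :=
  C1_open G F /\
  forall x, G x -> forall nu : 'I_p,
    partial (rshift m nu) F x
      + \sum_(j < m) a x j nu * partial (lshift p j) F x = 0.

Definition w_hat m p (w : 'rV[R]_(m + p) -> 'M[R]_(m, m + p))
    (x : 'rV[R]_(m + p)) : 'M[R]_m :=
  lsubmx (w x).

Definition a_hat m p (w : 'rV[R]_(m + p) -> 'M[R]_(m, m + p))
    (x : 'rV[R]_(m + p)) : 'M[R]_(m, p) :=
  - (invmx (w_hat w x) *m rsubmx (w x)).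

Definition vec_fun k n (F : 'I_k -> 'rV[R]_n -> R) (x : 'rV[R]_n) : 'rV[R]_k :=
  \row_(i < k) F i x.

Definition functionally_independent k n (G : set 'rV[R]_n)
    (F : 'I_k -> 'rV[R]_n -> R) : Prop :=
  measure_zero [set x | G x /\ \rank ('J (vec_fun F) x) <> k].

Definition is_basis k n (first_integral : ('rV[R]_n -> R) -> Prop)
    (G : set 'rV[R]_n) (F : 'I_k -> 'rV[R]_n -> R) : Prop :=
  [/\ forall i, first_integral (F i),
      functionally_independent G F &
      forall Psi, first_integral Psi ->
        exists Phi : 'rV[R]_k -> R,
          C1 (vec_fun F @` G) Phi /\
          (forall x, G x -> Psi x = Phi (vec_fun F x))].

End Pfaff.

(* Main.v *)
(* The two systems have the same first integrals on G', hence the same bases.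
   With (w_hat | W) the coefficient matrix, dF = a w for some row a iff
   a = (d_1 F, ..., d_m F) w_hat^-1 and the remaining partials equal a W, which
   is the total differential system; this a is continuous since the entries of
   w_hat^-1 are. *)
Require Import Defs.
From HB Require Import structures.
From mathcomp Require Import all_boot all_order all_algebra.
From mathcomp Require Import all_classical all_reals all_analysis.
From mathcomp Require Import ring.

Set Implicit Arguments.
Unset Strict Implicit.
Unset Printing Implicit Defensive.

Import Order.TTheory GRing.Theory Num.Theory.
Import numFieldNormedType.Exports.

Local Open Scope classical_set_scope.
Local Open Scope ring_scope.

Lemma cvg_mulmx (R : realType) (T : Type) (H : set_system T) (FH : Filter H)
    m n q (A : T -> 'M[R]_(m, n)) (B : T -> 'M[R]_(n, q))
    (A0 : 'M[R]_(m, n)) (B0 : 'M[R]_(n, q)) :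
  (forall i j, A t i j @[t --> H] --> A0 i j) ->
  (forall i j, B t i j @[t --> H] --> B0 i j) ->
  forall i j, (A t *m B t) i j @[t --> H] --> (A0 *m B0) i j.
Proof.
move=> AA0 BB0 i j; rewrite mxE; under eq_fun do rewrite mxE.
apply: cvg_big => [|k _]; first exact: add_continuous.
by apply: cvgM; [exact: AA0|exact: BB0].
Qed.

(** The Leibniz formula makes the determinant a finite sum of signed products of entries, and limits
    pass through both operations. *)
Lemma cvg_det (R : realType) (T : Type) (H : set_system T) (FH : Filter H) n
    (A : T -> 'M[R]_n) (B : 'M[R]_n) :
  (forall i j, A t i j @[t --> H] --> B i j) ->
  \det (A t) @[t --> H] --> \det B.
Proof.
move=> AB; rewrite /determinant.
apply: cvg_big => [|s _]; first exact: add_continuous.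
apply: cvgMl_tmp; apply: cvg_big => [|i _]; first exact: mul_continuous.
exact: AB.
Qed.

(** Cramer's rule: each entry of the inverse is a cofactor divided by the determinant, and both
    converge by [cvg_det]. *)
Lemma cvg_invmx (R : realType) (T : Type) (H : set_system T) (FH : Filter H) n
    (A : T -> 'M[R]_n) (B : 'M[R]_n) :
  B \in unitmx -> (\forall t \near H, A t \in unitmx) ->
  (forall i j, A t i j @[t --> H] --> B i j) ->
  forall i j, invmx (A t) i j @[t --> H] --> invmx B i j.
Proof.
move=> uB uA AB i j.
have -> : invmx B i j = (\det B)^-1 * cofactor B j i.
  by rewrite /invmx uB !mxE.
apply: (@cvg_trans _ ((\det (A t))^-1 * cofactor (A t) j i @[t --> H])).
  apply: near_eq_cvg; near=> t.
  have uAt : A t \in unitmx by near: t.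
  by rewrite /invmx uAt !mxE.
apply: cvgM.
  apply: cvgV; first by rewrite -unitfE -unitmxE.
  exact: cvg_det.
rewrite /cofactor; apply: cvgMl_tmp; apply: cvg_det => a b.
rewrite !mxE; under eq_fun do rewrite !mxE; exact: AB.
Unshelve. all: by end_near. Qed.

Definition gradient (R : realType) n (F : 'rV[R]_n -> R) (x : 'rV[R]_n) :
    'rV[R]_n := \row_i partial i F x.

Lemma diff_gradient (R : realType) n (F : 'rV[R]_n -> R) (x v : 'rV[R]_n) :
  differentiable F x -> 'd F x v = (v *m (gradient F x)^T) 0 0.
Proof.
move=> dF; rewrite [in LHS](row_sum_delta v) linear_sum /= mxE.
by apply: eq_bigr => i _; rewrite linearZ /= !mxE /partial deriveE.
Qed.

(** Both sides are linear in [v], so it is enough to compare them on the standard basis vectors;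
    this turns an identity of forms at [x] into one row equation. *)
Lemma diff_omegaP (R : realType) m n (w : 'rV[R]_n -> 'M[R]_(m, n))
    (F : 'rV[R]_n -> R) (x : 'rV[R]_n) (a : 'I_m -> R) :
  differentiable F x ->
  (forall v, 'd F x v = \sum_(j < m) a j * omega w j x v) <->
  gradient F x = (\row_j a j) *m w x.
Proof.
move=> dF.
have om v : \sum_(j < m) a j * omega w j x v
    = (v *m ((\row_j a j) *m w x)^T) 0 0.
  rewrite mxE; under [RHS]eq_bigr do rewrite !mxE mulr_sumr.
  rewrite exchange_big; apply: eq_bigr => j _; rewrite mulr_sumr.
  by apply: eq_bigr => i _; rewrite mxE; ring.
split=> [E|E v]; last by rewrite om diff_gradient // E.
apply/rowP => i; have := E (delta_mx 0 i).
by rewrite om diff_gradient // -!rowE !mxE => ->.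
Qed.

(** Compare column blocks: the first [m] columns can be solved uniquely for [a], and substituting
    this [a] into the last [p] columns leaves the second equation, its sign coming from the minus in
    [a_hat]. *)
Lemma gradient_total (R : realType) m p (w : 'rV[R]_(m + p) -> 'M[R]_(m, m + p))
    (x : 'rV[R]_(m + p)) (g : 'rV[R]_(m + p)) (a : 'rV[R]_m) :
  w_hat w x \in unitmx ->
  g = a *m w x <->
  a = lsubmx g *m invmx (w_hat w x) /\ rsubmx g + lsubmx g *m a_hat w x = 0.
Proof.
rewrite /a_hat /w_hat => u; rewrite mulmxN mulmxA.
split=> [->|[-> /eqP]].
  by rewrite -mulmx_lsub -mulmx_rsub mulmxK // subrr.
rewrite subr_eq0 => /eqP E.
by rewrite -[RHS]hsubmxK -mulmx_lsub -mulmx_rsub mulmxKV // -E hsubmxK.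
Qed.

Lemma total_gradientP (R : realType) m p (a : 'M[R]_(m, p))
    (F : 'rV[R]_(m + p) -> R) (x : 'rV[R]_(m + p)) :
  (forall nu, partial (rshift m nu) F x
      + \sum_(j < m) a j nu * partial (lshift p j) F x = 0) <->
  rsubmx (gradient F x) + lsubmx (gradient F x) *m a = 0.
Proof.
have E nu : (rsubmx (gradient F x) + lsubmx (gradient F x) *m a) 0 nu =
    partial (rshift m nu) F x
      + \sum_(j < m) a j nu * partial (lshift p j) F x.
  by rewrite !mxE; congr (_ + _); apply: eq_bigr => j _; rewrite !mxE mulrC.
split=> [H|H nu]; last by rewrite -E H mxE.
by apply/rowP => nu; rewrite E H mxE.
Qed.

Lemma pfaff_total_first_integral (R : realType) (m p : nat)
    (G : set 'rV[R]_(m + p)) (w : 'rV[R]_(m + p) -> 'M[R]_(m, m + p))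
    (F : 'rV[R]_(m + p) -> R) :
  open G ->
  (forall j i, {within G, continuous (fun x => w x j i)}) ->
  (forall x, G x -> w_hat w x \in unitmx) ->
  pfaff_first_integral w G F <-> total_first_integral (a_hat w) G F.
Proof.
move=> oG wG uG; split=> [[[dF cF]] [a [_ aF]]|[[dF cF] tF]].
  split=> // x Gx; apply/total_gradientP.
  have /diff_omegaP := aF x Gx; move=> /(_ (dF x Gx)).
  by move=> /gradient_total => /(_ (uG x Gx)) [].
split=> //.
(* By [gradient_total] no other coefficients are possible at points of [G]. *)
pose b x := lsubmx (gradient F x) *m invmx (w_hat w x).
exists (fun j x => b x 0 j); split=> [j|x Gx]; last first.
  apply/diff_omegaP; first exact: dF.
  have -> : \row_j b x 0 j = b x by apply/rowP => j; rewrite mxE.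
  by apply/gradient_total; [exact: uG|split=> //; apply/total_gradientP/tF].
(* As [G] is open, continuity within [G] amounts to convergence at each of its points, which the
   limit lemmas handle entry by entry. *)
rewrite continuous_open_subspace // => x /[!inE] Gx.
have cont f : {within G, continuous f} -> f y @[y --> x] --> (f x : R).
  by rewrite continuous_open_subspace // => /(_ x); rewrite inE; apply.
apply: (@cvg_mulmx _ _ (nbhs x)) => [i k|i k].
  by rewrite !mxE; under eq_fun do rewrite !mxE; exact/cont/cF.
apply: (@cvg_invmx _ _ (nbhs x)) => [||r s]; first exact: uG.
  (* A whole neighbourhood of [x] lies in [G], so [w_hat w] is invertible near [x]. *)
  by apply: filterS (open_nbhs_nbhs (conj oG Gx)) => y; exact: uG.
by rewrite mxE; under eq_fun do rewrite mxE; exact/cont/wG.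
Qed.

Theorem theorem4p16 (R : realType) (m p k : nat)
    (G Omega G' : set 'rV[R]_(m + p))
    (w : 'rV[R]_(m + p) -> 'M[R]_(m, m + p))
    (F : 'I_k -> 'rV[R]_(m + p) -> R)
    (domG : domain G)
    (w_cont : forall j i, {within G, continuous (fun x => w x j i)})
    (domOmega : domain Omega)
    (OmegaG : Omega `<=` G)
    (null_compl : measure_zero (G `\` Omega))
    (w_hat_nonsing : forall x, Omega x -> w_hat w x \in unitmx)
    (domG' : domain G')
    (G'Omega : G' `<=` Omega) :
  is_basis (pfaff_first_integral w G') G' F <->
  is_basis (total_first_integral (a_hat w) G') G' F.
Proof.
have fiP Psi : pfaff_first_integral w G' Psi <->
    total_first_integral (a_hat w) G' Psi.
  apply: pfaff_total_first_integral => [|j i|x G'x].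
  - by case: domG'.
  - exact: continuous_subspaceW (subset_trans G'Omega OmegaG) (w_cont j i).
  - exact/w_hat_nonsing/G'Omega.
(* [is_basis] sees the system only through its first integrals: [fiP] transfers both the members
   [F i] and the tested [Psi], while independence is common to both sides. *)
by split=> -[FI ind gen]; split=> // [i|Psi /fiP /gen //]; apply/fiP/FI.
Qed.
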